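(* The following properties are equivalent: (1) the sequence $(A_m)_{m\in\mathbb N}$ admits a nonuniform logarithmic dichotomy; (2) there are $C>0$ and $\varepsilon\ge0$ such that the sequence $(A_m)_{m\in\mathbb N}$ admits a nonuniform logarithmic dichotomy with respect to a sequence of norms $(\|\cdot\|_m)_{m\in\mathbb N}$ satisfying, for all $x\in X$ and $m\in\mathbb N$, $$\|x\|\le\|x\|_m\le C(\log(m+2))^{\varepsilon}\|x\|.$$
   Context: $\mathbb N=\{1,2,\dots\}$ and $\nu_n=\log(n+1)$ (natural logarithm) for $n\in\mathbb N$. $(X,\|\cdot\|)$ is a Banach space and $(A_n)_{n\in\mathbb N}$ is a sequence of bounded linear operators on $X$. For $m\ge n$, $\mathcal A_{m,n}=A_{m-1}\cdots A_n$ if $m>n$ and $\mathcal A_{m,n}=\mathrm{Id}$ if $m=n$. Both notions below require projections $P_m$, $m\in\mathbb N$, on $X$ such that $A_m|_{\ker P_m}:\ker P_m\to\ker P_{m+1}$ is invertible for all $m$ and $P_m\mathcal A_{m,n}=\mathcal A_{m,n}P_n$ for $m\ge n$; write $Q_n=\mathrm{Id}-P_n$ and, for $m\le n$, $\mathcal A_{m,n}=(\mathcal A_{n,m})^{-1}:\ker P_n\to\ker P_m$. $(A_m)$ admits a nonuniform logarithmic dichotomy if there are such projections and constants $\lambda,D>0$ and $\varepsilon>0$ such that $\|\mathcal A_{m,n}P_n\|\le D(\nu_m/\nu_n)^{-\lambda}\nu_n^{\varepsilon}$ for $m\ge n$ and $\|\mathcal A_{m,n}Q_n\|\le D(\nu_n/\nu_m)^{-\lambda}\nu_n^{\varepsilon}$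 for $m\le n$. Given a sequence of norms $(\|\cdot\|_m)_{m\in\mathbb N}$ on $X$, each equivalent to $\|\cdot\|$, $(A_m)$ admits a nonuniform logarithmic dichotomy with respect to $(\|\cdot\|_m)$ if there are such projections and constants $\lambda,D>0$ such that, for all $x\in X$, $\|\mathcal A_{m,n}P_nx\|_m\le D(\nu_m/\nu_n)^{-\lambda}\|x\|_n$ for $m\ge n$ and $\|\mathcal A_{m,n}Q_nx\|_m\le D(\nu_n/\nu_m)^{-\lambda}\|x\|_n$ for $m\le n$. *)

(* Defs.v *)
From Stdlib Require Import Reals.
From Coquelicot Require Import Coquelicot.

Set Implicit Arguments.
Unset Strict Implicit.
Unset Printing Implicit Defensive.

Open Scope R_scope.

(* Banach spaces are taken over the real or over the complex numbers, i.e.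
   X : CompleteNormedModule (scalars k).  Sequences indexed by {1, 2, ...} are
   functions on nat; their value at 0 is never constrained nor used. *)
Inductive scalar_field := RealScalars | ComplexScalars.

Definition scalars (k : scalar_field) : AbsRing :=
  match k with
  | RealScalars => R_AbsRing
  | ComplexScalars => C_AbsRing
  end.

Definition nu (n : nat) : R := ln (INR n + 1).

Section LogarithmicDichotomies.

Context {K : AbsRing} {X : CompleteNormedModule K}.

Definition op_norm (T : X -> X) : Rbar :=
  Lub_Rbar (fun r => exists x : X, norm x <= 1 /\ r = norm (T x)).

Definition ker (T : X -> X) (x : X) : Prop := T x = zero.

(* A (m-1) o ... o A n if n < m, and the identity if n = m
   (also if m < n, a case in which it is not used). *)
Fixpoint evol (A : nat -> X -> X) (m n : nat) (x : X) : X :=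
  match m with
  | O => x
  | S m' => if (n <=? m')%nat then A m' (evol A m' n x) else x
  end.

(* For m <= n, the inverse of evol A n m : ker (P m) -> ker (P n), evaluated
   at x in ker (P n); meaningful once that map is bijective. *)
Definition evol_inv (A P : nat -> X -> X) (m n : nat) (x : X) : X :=
  iota (fun y => ker (P m) y /\ evol A n m y = x).

Definition compl_proj (P : nat -> X -> X) (n : nat) (x : X) : X :=
  minus x (P n x).

Record is_projection (T : X -> X) : Prop := {
  projection_linear : is_linear T;
  projection_idem : forall x : X, T (T x) = T x
}.

Definition bijective_on (T : X -> X) (E F : X -> Prop) : Prop :=
  (forall x : X, E x -> F (T x)) /\
  (forall y : X, F y -> exists! x : X, E x /\ T x = y).

Record dichotomy_projections (A P : nat -> X -> X) : Prop := {
  dichotomy_projection : forall m : nat, (1 <= m)%nat -> is_projection (P m);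
  dichotomy_invertible : forall m : nat, (1 <= m)%nat ->
    bijective_on (A m) (ker (P m)) (ker (P (S m)));
  dichotomy_commute : forall m n : nat, (1 <= n)%nat -> (n <= m)%nat ->
    forall x : X, P m (evol A m n x) = evol A m n (P n x)
}.

Definition nonuniform_log_dichotomy (A : nat -> X -> X) : Prop :=
  exists (P : nat -> X -> X) (lambda D eps : R),
    0 < lambda /\ 0 < D /\ 0 < eps /\
    dichotomy_projections A P /\
    (forall m n : nat, (1 <= n)%nat -> (n <= m)%nat ->
      Rbar_le (op_norm (fun x => evol A m n (P n x)))
        (D * Rpower (nu m / nu n) (- lambda) * Rpower (nu n) eps)) /\
    (forall m n : nat, (1 <= m)%nat -> (m <= n)%nat ->
      Rbar_le (op_norm (fun x => evol_inv A P m n (compl_proj P n x)))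
        (D * Rpower (nu n / nu m) (- lambda) * Rpower (nu n) eps)).

Record is_norm (N : X -> R) : Prop := {
  norm_nonneg : forall x : X, 0 <= N x;
  norm_definite : forall x : X, N x = 0 -> x = zero;
  norm_homogeneous : forall (a : K) (x : X), N (scal a x) = abs a * N x;
  norm_subadditive : forall x y : X, N (plus x y) <= N x + N y
}.

Definition is_equivalent_norm (N : X -> R) : Prop :=
  is_norm N /\
  exists a b : R, 0 < a /\ 0 < b /\
    forall x : X, a * norm x <= N x /\ N x <= b * norm x.

Definition nonuniform_log_dichotomy_wrt
    (A : nat -> X -> X) (N : nat -> X -> R) : Prop :=
  exists (P : nat -> X -> X) (lambda D : R),
    0 < lambda /\ 0 < D /\
    dichotomy_projections A P /\
    (forall m n : nat, (1 <= n)%nat -> (n <= m)%nat -> forall x : X,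
      N m (evol A m n (P n x)) <=
        D * Rpower (nu m / nu n) (- lambda) * N n x) /\
    (forall m n : nat, (1 <= m)%nat -> (m <= n)%nat -> forall x : X,
      N m (evol_inv A P m n (compl_proj P n x)) <=
        D * Rpower (nu n / nu m) (- lambda) * N n x).

End LogarithmicDichotomies.

(* Main.v *)
Require Import Defs.
From Stdlib Require Import Reals.
From Coquelicot Require Import Coquelicot.
From Stdlib Require Import Lia Lra.

(** The equivalence rests on adapted (Lyapunov) norms, which hide the
    nonuniform factor [nu n ^ eps] inside the norm.  From projections [P] and
    an exponent [lambda], put

      N m x =   sup over j >= m of (nu j / nu m)^lambda |A_{j,m} P_m x|
              + sup over 1 <= j <= m of (nu m / nu j)^lambda |A_{j,m} Q_m x|.

    The nonuniform bounds say exactly that each supremum is at most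
    [D (nu m)^eps |x|], and the terms [j = m] add up to at least [|x|], because
    [P_m x + Q_m x = x].  Moreover the stable maps [A_{m,n} P_n] and the
    unstable maps [A_{m,n} Q_n] compose as two semigroups annihilating each
    other ([stable_stable], [unstable_unstable], [unstable_stable],
    [stable_unstable]).  Hence moving along the dynamics replaces one of the
    suprema by a supremum over fewer indices, rescaled by a power of [nu]
    because the weights are multiplicative ([ratio_power_chain]), and kills the
    other one: the dichotomy holds for [N] with constant 1
    ([lyapunov_stable_bound], [lyapunov_unstable_bound]).

    Conversely, the comparison between [norm] and [N m] turns the bounds for
    [N] into bounds for [norm] with the extra factor
    [(log (n + 2))^eps], and [log (n + 2) <= 2 log (n + 1)].  A dichotomy asks
    for a positive exponent, so [eps], which may vanish, is raised to
    [eps + 1] at the cost of a factor [1 / log 2] ([growth_le_nu_power]). *)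

(** * Scalars and operator norms *)

Lemma scalars_abs_inverse (k : scalar_field) (a : scalars k) :
  abs a <> 0 -> exists b : scalars k, mult b a = one /\ abs b * abs a = 1.
Proof.
destruct k; simpl in *; intros ha.
- assert (ha' : a <> 0) by (intros ->; apply ha; apply Rabs_R0).
  exists (/ a); split.
  + change (/ a * a = 1); now apply Rinv_l.
  + change (Rabs (/ a) * Rabs a = 1).
    rewrite <- Rabs_mult, Rinv_l by assumption; apply Rabs_R1.
- assert (ha' : a <> RtoC 0) by (intros ->; apply ha; apply Cmod_0).
  exists (Cinv a); split.
  + change (Cmult (Cinv a) a = RtoC 1); now apply Cinv_l.
  + change (Cmod (Cinv a) * Cmod a = 1).
    rewrite <- Cmod_mult, Cinv_l by assumption; apply Cmod_1.
Qed.

Lemma scalars_abs_onto (k : scalar_field) (r : R) :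
  0 < r -> exists a : scalars k, abs a = r.
Proof.
intros hr; destruct k; simpl.
- exists r; apply Rabs_pos_eq; lra.
- exists (RtoC r); change (Cmod (RtoC r) = r).
  rewrite Cmod_R; apply Rabs_pos_eq; lra.
Qed.

(** Boundedness is left out: the inverses along the kernels of the projections
    are only known to be bounded through the dichotomy estimates. *)
Definition algebraically_linear {K : AbsRing} {V : NormedModule K} (T : V -> V) :=
  (forall x y : V, T (plus x y) = plus (T x) (T y)) /\
  (forall (a : K) (x : V), T (scal a x) = scal a (T x)).

Lemma algebraically_linear_zero {K : AbsRing} {V : NormedModule K}
    (T : V -> V) :
  algebraically_linear T -> T zero = zero.
Proof.
intros [_ hT]; transitivity (T (scal zero zero)).
- f_equal; symmetry; apply (scal_zero_l (V := V)).
- rewrite hT; apply (scal_zero_l (V := V)).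
Qed.

Lemma minus_plus_plus {G : AbelianGroup} (x y u v : G) :
  minus (plus x y) (plus u v) = plus (minus x u) (minus y v).
Proof.
unfold minus; rewrite opp_plus, <- !plus_assoc; f_equal.
rewrite !plus_assoc; f_equal; apply plus_comm.
Qed.

Lemma plus_minus_cancel {G : AbelianGroup} (x y : G) :
  plus x (minus y x) = y.
Proof.
unfold minus.
now rewrite (plus_comm y), plus_assoc, plus_opp_r, plus_zero_l.
Qed.

Lemma is_linear_algebraically {K : AbsRing} {V : NormedModule K} (T : V -> V) :
  is_linear T -> algebraically_linear T.
Proof.
intros hT; split; [apply linear_plus | apply linear_scal]; exact hT.
Qed.

(** An inequality for all scalars, applied to a scalar and to its inverse,
    gives an equality.  This serves both for the ambient norm, which is only
    assumed to satisfy the inequality, and for the norms built as suprema. *)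
Lemma homogeneous_of_le (k : scalar_field) (V : NormedModule (scalars k))
    (N : V -> R) :
  (forall x : V, 0 <= N x) ->
  (forall (a : scalars k) (x : V), N (scal a x) <= abs a * N x) ->
  forall (a : scalars k) (x : V), N (scal a x) = abs a * N x.
Proof.
intros N_ge0 N_scal a x.
apply Rle_antisym; [apply N_scal | ].
destruct (Req_dec (abs a) 0) as [ha | ha].
- rewrite ha, Rmult_0_l; apply N_ge0.
- destruct (scalars_abs_inverse k a ha) as [b [hb hab]].
  assert (h : N x <= abs b * N (scal a x)).
  { rewrite <- (scal_one x) at 1; rewrite <- hb, <- scal_assoc.
    apply N_scal. }
  apply (Rmult_le_compat_l (abs a)) in h; [ | apply abs_ge_0].
  replace (abs a * (abs b * N (scal a x)))
    with (abs b * abs a * N (scal a x)) in h by ring.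
  rewrite hab in h; lra.
Qed.

Lemma norm_scal_eq (k : scalar_field) (V : NormedModule (scalars k))
    (a : scalars k) (x : V) : norm (scal a x) = abs a * norm x.
Proof.
apply (homogeneous_of_le k V norm norm_ge_0 (@norm_scal _ V)).
Qed.

(** The supremum over the unit ball controls every vector by rescaling it into
    the ball, which is possible since every positive real is the absolute value
    of some scalar. *)
Lemma op_norm_le_iff (k : scalar_field) (X : CompleteNormedModule (scalars k))
    (T : X -> X) (M : R) :
  algebraically_linear T -> 0 <= M ->
  Rbar_le (op_norm T) M <-> (forall x : X, norm (T x) <= M * norm x).
Proof.
intros hT hM; unfold op_norm.
destruct (Lub_Rbar_correct
  (fun r => exists x : X, norm x <= 1 /\ r = norm (T x))) as [ub least].
split.
- intros hle x.
  destruct (Req_dec (norm x) 0) as [hx | hx].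
  + rewrite (norm_eq_zero x hx), (algebraically_linear_zero T hT), !norm_zero.
    lra.
  + assert (hpos : 0 < norm x) by (generalize (norm_ge_0 x); lra).
    destruct (scalars_abs_onto k (/ norm x)) as [a ha];
      [now apply Rinv_0_lt_compat | ].
    assert (h : norm (T (scal a x)) <= M).
    { apply (Rbar_le_trans (norm (T (scal a x))) _ M (ub _ ltac:(
        exists (scal a x); split; [ | reflexivity];
        rewrite norm_scal_eq, ha, Rinv_l; lra)) hle). }
    rewrite (proj2 hT), norm_scal_eq, ha in h.
    apply (Rmult_le_compat_l (norm x)) in h; [ | lra].
    rewrite <- Rmult_assoc, Rinv_r in h by exact hx; lra.
- intros hle; apply least; intros r [x [hx ->]]; simpl.
  apply Rle_trans with (1 := hle x).
  rewrite <- (Rmult_1_r M) at 2; now apply Rmult_le_compat_l.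
Qed.

Lemma norm_eq_0_of_zero {K : AbsRing} {X : CompleteNormedModule K} (x : X) :
  x = zero -> norm x = 0.
Proof. intros ->; apply (norm_zero (V := X)). Qed.

(** * Suprema of weighted families *)

(** Real-valued, so a genuine supremum only for nonempty index sets and bounded
    families. *)
Definition sup_over (I : nat -> Prop) (u : nat -> R) : R :=
  real (Lub_Rbar (fun r => exists j : nat, I j /\ r = u j)).

Lemma is_lub_sup_over (I : nat -> Prop) (u : nat -> R) (i : nat) (M : R) :
  I i -> (forall j, I j -> u j <= M) ->
  is_lub_Rbar (fun r => exists j : nat, I j /\ r = u j) (sup_over I u).
Proof.
intros hi hM; unfold sup_over.
destruct (Lub_Rbar_correct (fun r => exists j : nat, I j /\ r = u j))
  as [ub least].
assert (h1 : Rbar_le (u i) (Lub_Rbar (fun r => exists j, I j /\ r = u j)))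
  by (apply ub; now exists i).
assert (h2 : Rbar_le (Lub_Rbar (fun r => exists j, I j /\ r = u j)) M)
  by (apply least; intros r [j [hj ->]]; now apply hM).
(* The supremum lies between two reals, so taking its real part loses
   nothing. *)
destruct (Lub_Rbar (fun r => exists j, I j /\ r = u j)) as [s | | ];
  simpl in *; [now split | tauto | tauto].
Qed.

Lemma sup_over_ge (I : nat -> Prop) (u : nat -> R) (i : nat) (M : R) :
  I i -> (forall j, I j -> u j <= M) -> u i <= sup_over I u.
Proof.
intros hi hM; destruct (is_lub_sup_over I u i M hi hM) as [ub _].
apply (ub (u i)); now exists i.
Qed.

Lemma sup_over_le (I : nat -> Prop) (u : nat -> R) (i : nat) (M : R) :
  I i -> (forall j, I j -> u j <= M) -> sup_over I u <= M.
Proof.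
intros hi hM; destruct (is_lub_sup_over I u i M hi hM) as [_ least].
apply (least M); intros r [j [hj ->]]; now apply hM.
Qed.

Section WeightedSuprema.

Context {k : scalar_field} {X : CompleteNormedModule (scalars k)}.
Context {I : nat -> Prop} {w : nat -> R} {T : nat -> X -> X} {i : nat} {M : R}.
Hypothesis I_i : I i.
Hypothesis w_ge0 : forall j : nat, I j -> 0 <= w j.
Hypothesis T_linear : forall j : nat, I j -> algebraically_linear (T j).
Hypothesis T_bounded : forall (j : nat) (x : X), I j ->
  w j * norm (T j x) <= M * norm x.

Let seminorm (x : X) := sup_over I (fun j => w j * norm (T j x)).

Lemma weighted_sup_ge (j : nat) (x : X) :
  I j -> w j * norm (T j x) <= seminorm x.
Proof.
intros hj.
apply (sup_over_ge I (fun j => w j * norm (T j x)) j (M * norm x) hj).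
intros l; apply T_bounded.
Qed.

Lemma weighted_sup_bounded (x : X) : seminorm x <= M * norm x.
Proof.
apply (sup_over_le _ _ i); [exact I_i | intros j; apply T_bounded].
Qed.

Lemma weighted_sup_nonneg (x : X) : 0 <= seminorm x.
Proof.
apply Rle_trans with (2 := weighted_sup_ge i x I_i).
apply Rmult_le_pos; [now apply w_ge0 | apply norm_ge_0].
Qed.

Lemma weighted_sup_scal_le (a : scalars k) (x : X) :
  seminorm (scal a x) <= abs a * seminorm x.
Proof.
apply (sup_over_le _ _ i _ I_i); intros j hj.
rewrite (proj2 (T_linear j hj)), norm_scal_eq.
replace (w j * (abs a * norm (T j x)))
  with (abs a * (w j * norm (T j x))) by ring.
apply Rmult_le_compat_l; [apply abs_ge_0 | now apply weighted_sup_ge].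
Qed.

Lemma weighted_sup_subadditive (x y : X) :
  seminorm (plus x y) <= seminorm x + seminorm y.
Proof.
apply (sup_over_le _ _ i _ I_i); intros j hj.
rewrite (proj1 (T_linear j hj)).
apply Rle_trans with (w j * norm (T j x) + w j * norm (T j y)).
- rewrite <- Rmult_plus_distr_l.
  apply Rmult_le_compat_l; [now apply w_ge0 | apply norm_triangle].
- apply Rplus_le_compat; now apply weighted_sup_ge.
Qed.

End WeightedSuprema.

(** * Powers of logarithms *)

Lemma nu_ge_ln2 (n : nat) : (1 <= n)%nat -> ln 2 <= nu n.
Proof.
intros hn; unfold nu; apply le_INR in hn; simpl in hn.
destruct (Req_dec (INR n) 1) as [-> | hne].
- right; f_equal; lra.
- left; apply ln_increasing; lra.
Qed.

Lemma ln2_pos : 0 < ln 2.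
Proof. rewrite <- ln_1; apply ln_increasing; lra. Qed.

Lemma nu_pos (n : nat) : (1 <= n)%nat -> 0 < nu n.
Proof. intros hn; generalize (nu_ge_ln2 n hn) ln2_pos; lra. Qed.

Lemma nu_le_ln_add2 (n : nat) : nu n <= ln (INR n + 2).
Proof.
unfold nu; left; apply ln_increasing; generalize (pos_INR n); lra.
Qed.

Lemma ln_add2_le (n : nat) : (1 <= n)%nat -> ln (INR n + 2) <= 2 * nu n.
Proof.
intros hn; unfold nu; apply le_INR in hn; simpl in hn.
replace (2 * ln (INR n + 1)) with (ln (INR n + 1) + ln (INR n + 1)) by ring.
rewrite <- ln_mult by lra.
left; apply ln_increasing; nra.
Qed.

Lemma Rpower_pos (a b : R) : 0 < Rpower a b.
Proof. apply exp_pos. Qed.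

Lemma Rpower_base1 (l : R) : Rpower 1 l = 1.
Proof. unfold Rpower; now rewrite ln_1, Rmult_0_r, exp_0. Qed.

Lemma ratio_power_chain (a b c l : R) : 0 < a -> 0 < b -> 0 < c ->
  Rpower (a / b) l * Rpower (b / c) l = Rpower (a / c) l.
Proof.
intros ha hb hc.
rewrite Rpower_mult_distr by now apply Rdiv_lt_0_compat.
f_equal; field; lra.
Qed.

Lemma ratio_power_opp (a b l : R) : 0 < a -> 0 < b ->
  Rpower (a / b) (- l) = Rpower (b / a) l.
Proof.
intros ha hb; unfold Rpower, Rdiv; f_equal.
rewrite !ln_mult, !ln_Rinv by (try apply Rinv_0_lt_compat; assumption); ring.
Qed.

(** The exponent is increased by one so as to be positive; the lost factor
    [nu n] is at least [ln 2]. *)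
Lemma growth_le_nu_power (eps : R) (n : nat) : 0 <= eps -> (1 <= n)%nat ->
  Rpower (ln (INR n + 2)) eps
    <= Rpower 2 eps * / ln 2 * Rpower (nu n) (eps + 1).
Proof.
intros heps hn.
assert (hnu := nu_pos n hn); assert (hln2 := ln2_pos).
apply Rle_trans with (Rpower (2 * nu n) eps).
- apply Rle_Rpower_l; [exact heps | split; [ | now apply ln_add2_le]].
  generalize (nu_le_ln_add2 n); lra.
- rewrite <- Rpower_mult_distr by lra.
  rewrite Rpower_plus, Rpower_1 by exact hnu.
  replace (Rpower 2 eps * / ln 2 * (Rpower (nu n) eps * nu n))
    with (Rpower 2 eps * Rpower (nu n) eps * (nu n / ln 2)) by (field; lra).
  rewrite <- (Rmult_1_r (Rpower 2 eps * Rpower (nu n) eps)) at 1.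
  apply Rmult_le_compat_l.
  + apply Rmult_le_pos; left; apply Rpower_pos.
  + apply Rmult_le_reg_r with (1 := hln2).
    replace (nu n / ln 2 * ln 2) with (nu n) by (field; lra).
    generalize (nu_ge_ln2 n hn); lra.
Qed.

(** * The stable and unstable semigroups *)

Lemma evol_id {K : AbsRing} {X : CompleteNormedModule K}
    (A : nat -> X -> X) (n : nat) (x : X) : evol A n n x = x.
Proof.
destruct n as [ | n]; [reflexivity | ].
change (evol A (S n) (S n) x)
  with (if (S n <=? n)%nat then A n (evol A n (S n) x) else x).
now rewrite (proj2 (Nat.leb_gt (S n) n) ltac:(lia)).
Qed.

Lemma evol_step {K : AbsRing} {X : CompleteNormedModule K}
    (A : nat -> X -> X) (m n : nat) (x : X) :
  (n <= m)%nat -> evol A (S m) n x = A m (evol A m n x).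
Proof.
intros h.
change (evol A (S m) n x)
  with (if (n <=? m)%nat then A m (evol A m n x) else x).
now rewrite (proj2 (Nat.leb_le n m) h).
Qed.

Lemma evol_comp {K : AbsRing} {X : CompleteNormedModule K}
    (A : nat -> X -> X) (j m n : nat) (x : X) :
  (n <= m)%nat -> (m <= j)%nat ->
  evol A j m (evol A m n x) = evol A j n x.
Proof.
intros hnm hmj; induction hmj as [ | j hmj IH].
- apply evol_id.
- rewrite !evol_step by lia; now rewrite IH.
Qed.

Section Semigroups.

Context {K : AbsRing} {X : CompleteNormedModule K}.
Context {A P : nat -> X -> X}.
Hypothesis A_linear : forall m : nat, (1 <= m)%nat -> is_linear (A m).
Hypothesis AP : dichotomy_projections A P.

Lemma evol_linear (m n : nat) : (1 <= n)%nat -> (n <= m)%nat ->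
  algebraically_linear (evol A m n).
Proof.
intros hn hnm; induction hnm as [ | m hnm [IHplus IHscal]].
- split; intros; now rewrite !evol_id.
- assert (hA := A_linear m ltac:(lia)).
  split; intros; rewrite !evol_step by assumption.
  + rewrite IHplus; now apply linear_plus.
  + rewrite IHscal; now apply linear_scal.
Qed.

Lemma projection_algebraically_linear (n : nat) : (1 <= n)%nat ->
  algebraically_linear (P n).
Proof.
intros hn; apply is_linear_algebraically.
apply (projection_linear (dichotomy_projection AP hn)).
Qed.

Lemma projection_ker_zero (n : nat) : (1 <= n)%nat -> ker (P n) zero.
Proof.
intros hn; apply (algebraically_linear_zero (P n)).
now apply projection_algebraically_linear.
Qed.

Lemma compl_proj_linear (n : nat) : (1 <= n)%nat ->
  algebraically_linear (compl_proj P n).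
Proof.
intros hn; destruct (projection_algebraically_linear n hn) as [hplus hscal].
split; intros; unfold compl_proj.
- rewrite hplus; apply (minus_plus_plus (G := X)).
- rewrite hscal; symmetry; apply (scal_minus_distr_l (V := X)).
Qed.

Lemma compl_proj_ker (n : nat) (x : X) : (1 <= n)%nat ->
  ker (P n) (compl_proj P n x).
Proof.
intros hn; destruct (dichotomy_projection AP hn) as [lin idem].
unfold ker, compl_proj, minus.
transitivity (plus (P n x) (P n (opp (P n x)))); [apply (linear_plus _ lin) | ].
transitivity (plus (P n x) (opp (P n (P n x)))).
- f_equal; apply (linear_opp _ _ lin).
- rewrite idem; apply (plus_opp_r (G := X)).
Qed.

Lemma compl_proj_of_ker (n : nat) (x : X) :
  ker (P n) x -> compl_proj P n x = x.
Proof.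
unfold ker, compl_proj; intros ->; apply (minus_zero_r (G := X)).
Qed.

Lemma evol_bijective (m n : nat) : (1 <= m)%nat -> (m <= n)%nat ->
  bijective_on (evol A n m) (ker (P m)) (ker (P n)).
Proof.
intros hm hmn; induction hmn as [ | n hmn [IHmap IHinv]].
- split.
  + intros x hx; now rewrite evol_id.
  + intros y hy; exists y; split.
    * split; [exact hy | apply evol_id].
    * intros z [_ hz]; now rewrite evol_id in hz.
- destruct (dichotomy_invertible AP (m := n) ltac:(lia)) as [Amap Ainv].
  split.
  + intros x hx; rewrite evol_step by exact hmn; now apply Amap, IHmap.
  + intros y hy.
    destruct (Ainv y hy) as [z [[hz hAz] zuniq]].
    destruct (IHinv z hz) as [x [[hx hEx] xuniq]].
    exists x; split.
    * split; [exact hx | ].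
      rewrite evol_step by exact hmn; now rewrite hEx.
    * intros x' [hx' hEx']; rewrite evol_step in hEx' by exact hmn.
      apply xuniq; split; [exact hx' | symmetry].
      apply zuniq; split; [now apply IHmap | exact hEx'].
Qed.

(** Bijectivity makes the preimage unique, which is what the description
    operator in [evol_inv] needs to return it. *)
Lemma evol_inv_spec (m n : nat) (x : X) :
  (1 <= m)%nat -> (m <= n)%nat -> ker (P n) x ->
  ker (P m) (evol_inv A P m n x) /\ evol A n m (evol_inv A P m n x) = x.
Proof.
intros hm hmn hx; unfold evol_inv.
apply (iota_correct (fun y => ker (P m) y /\ evol A n m y = x)).
now apply (proj2 (evol_bijective m n hm hmn)).
Qed.

Lemma evol_inv_unique (m n : nat) (y : X) :
  (1 <= m)%nat -> (m <= n)%nat -> ker (P m) y ->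
  evol_inv A P m n (evol A n m y) = y.
Proof.
intros hm hmn hy.
destruct (evol_bijective m n hm hmn) as [hmap hinv].
destruct (hinv _ (hmap y hy)) as [z [_ zuniq]].
apply (iota_unique (fun y' => ker (P m) y' /\ evol A n m y' = evol A n m y)).
- intros y' hy'; transitivity z; [symmetry | ]; now apply zuniq.
- now split.
Qed.

Definition stable (B Q : nat -> X -> X) (m n : nat) (x : X) : X :=
  evol B m n (Q n x).

Definition unstable (B Q : nat -> X -> X) (m n : nat) (x : X) : X :=
  evol_inv B Q m n (compl_proj Q n x).

Lemma stable_linear (m n : nat) : (1 <= n)%nat -> (n <= m)%nat ->
  algebraically_linear (stable A P m n).
Proof.
intros hn hnm; unfold stable.
destruct (evol_linear m n hn hnm) as [Eplus Escal].
destruct (projection_algebraically_linear n hn) as [Pplus Pscal].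
split; intros; [now rewrite Pplus, Eplus | now rewrite Pscal, Escal].
Qed.

Lemma unstable_spec (m n : nat) (x : X) : (1 <= m)%nat -> (m <= n)%nat ->
  ker (P m) (unstable A P m n x) /\
  evol A n m (unstable A P m n x) = compl_proj P n x.
Proof.
intros hm hmn; apply evol_inv_spec; try assumption.
apply compl_proj_ker; lia.
Qed.

(** Uniqueness of the preimage in the kernel reduces identities between values
    of backward maps to computations forward in time. *)
Lemma unstable_eq (m n : nat) (x y : X) : (1 <= m)%nat -> (m <= n)%nat ->
  ker (P m) y -> evol A n m y = compl_proj P n x -> unstable A P m n x = y.
Proof.
intros hm hmn hy hE; unfold unstable; rewrite <- hE.
now apply evol_inv_unique.
Qed.

Lemma unstable_linear (m n : nat) : (1 <= m)%nat -> (m <= n)%nat ->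
  algebraically_linear (unstable A P m n).
Proof.
intros hm hmn.
destruct (evol_linear n m hm hmn) as [Eplus Escal].
destruct (projection_algebraically_linear m hm) as [Pplus Pscal].
destruct (compl_proj_linear n ltac:(lia)) as [Qplus Qscal].
split.
- intros x y; destruct (unstable_spec m n x hm hmn) as [hx Ex].
  destruct (unstable_spec m n y hm hmn) as [hy Ey].
  apply unstable_eq; try assumption.
  + unfold ker in *; rewrite Pplus, hx, hy; apply (plus_zero_l (G := X)).
  + now rewrite Eplus, Qplus, Ex, Ey.
- intros a x; destruct (unstable_spec m n x hm hmn) as [hx Ex].
  apply unstable_eq; try assumption.
  + unfold ker in *; rewrite Pscal, hx; apply (scal_zero_r (V := X)).
  + now rewrite Escal, Qscal, Ex.
Qed.

Lemma stable_range (m n : nat) (x : X) : (1 <= n)%nat -> (n <= m)%nat ->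
  P m (stable A P m n x) = stable A P m n x.
Proof.
intros hn hnm; unfold stable; rewrite (dichotomy_commute AP) by assumption.
now rewrite (projection_idem (dichotomy_projection AP hn)).
Qed.

Lemma stable_stable (j m n : nat) (x : X) :
  (1 <= n)%nat -> (n <= m)%nat -> (m <= j)%nat ->
  stable A P j m (stable A P m n x) = stable A P j n x.
Proof.
intros hn hnm hmj; unfold stable at 1; rewrite stable_range by assumption.
now apply evol_comp.
Qed.

Lemma unstable_unstable (j m n : nat) (x : X) :
  (1 <= j)%nat -> (j <= m)%nat -> (m <= n)%nat ->
  unstable A P j m (unstable A P m n x) = unstable A P j n x.
Proof.
intros hj hjm hmn.
destruct (unstable_spec j n x hj ltac:(lia)) as [hker hE].
destruct (unstable_spec m n x ltac:(lia) hmn) as [hker' _].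
apply unstable_eq; try assumption.
rewrite (compl_proj_of_ker m _ hker'); symmetry.
apply unstable_eq; try lia.
- now apply (proj1 (evol_bijective j m hj hjm)).
- now rewrite evol_comp.
Qed.

Lemma unstable_stable (j m n : nat) (x : X) :
  (1 <= n)%nat -> (n <= m)%nat -> (1 <= j)%nat -> (j <= m)%nat ->
  unstable A P j m (stable A P m n x) = zero.
Proof.
intros hn hnm hj hjm.
apply unstable_eq; try assumption; [now apply projection_ker_zero | ].
unfold compl_proj; rewrite stable_range by assumption.
transitivity (zero : X).
- apply (algebraically_linear_zero (evol A m j)); now apply evol_linear.
- symmetry; apply (minus_eq_zero (G := X)).
Qed.

Lemma stable_unstable (j m n : nat) (x : X) :
  (1 <= m)%nat -> (m <= n)%nat -> (m <= j)%nat ->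
  stable A P j m (unstable A P m n x) = zero.
Proof.
intros hm hmn hmj; unfold stable.
destruct (unstable_spec m n x hm hmn) as [hker _].
unfold ker in hker; rewrite hker.
apply (algebraically_linear_zero (evol A j m)).
now apply evol_linear.
Qed.

Lemma stable_plus_unstable (n : nat) (x : X) : (1 <= n)%nat ->
  plus (stable A P n n x) (unstable A P n n x) = x.
Proof.
intros hn; unfold stable; rewrite evol_id.
rewrite (unstable_eq n n x (compl_proj P n x)); try lia.
- apply (plus_minus_cancel (G := X)).
- now apply compl_proj_ker.
- apply evol_id.
Qed.

End Semigroups.

(** * Lyapunov norms *)

Section LyapunovNorms.

Context {k : scalar_field} {X : CompleteNormedModule (scalars k)}.
Context {A P : nat -> X -> X} {lambda D eps : R}.
Hypothesis A_linear : forall m : nat, (1 <= m)%nat -> is_linear (A m).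
Hypothesis AP : dichotomy_projections A P.
Hypothesis D_pos : 0 < D.
Hypothesis stable_bound : forall m n : nat, (1 <= n)%nat -> (n <= m)%nat ->
  Rbar_le (op_norm (stable A P m n))
    (D * Rpower (nu m / nu n) (- lambda) * Rpower (nu n) eps).
Hypothesis unstable_bound : forall m n : nat, (1 <= m)%nat -> (m <= n)%nat ->
  Rbar_le (op_norm (unstable A P m n))
    (D * Rpower (nu n / nu m) (- lambda) * Rpower (nu n) eps).

Let ahead (m j : nat) : Prop := (m <= j)%nat.
Let behind (m j : nat) : Prop := (1 <= j)%nat /\ (j <= m)%nat.
Let stable_weight (m j : nat) := Rpower (nu j / nu m) lambda.
Let unstable_weight (m j : nat) := Rpower (nu m / nu j) lambda.

Let stable_sup (m : nat) (x : X) : R :=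
  sup_over (ahead m) (fun j => stable_weight m j * norm (stable A P j m x)).

Let unstable_sup (m : nat) (x : X) : R :=
  sup_over (behind m) (fun j => unstable_weight m j * norm (unstable A P j m x)).

Definition lyapunov_norm (m : nat) (x : X) : R :=
  stable_sup m x + unstable_sup m x.

Lemma weighted_bound (r B x : R) :
  0 < r -> x <= D * Rpower r (- lambda) * B -> Rpower r lambda * x <= D * B.
Proof.
intros hr hx; apply (Rmult_le_compat_l (Rpower r lambda)) in hx;
  [ | left; apply Rpower_pos].
replace (D * B) with (Rpower r lambda * (D * Rpower r (- lambda) * B));
  [exact hx | ].
rewrite Rpower_Ropp; field; apply Rgt_not_eq, Rpower_pos.
Qed.

Lemma stable_terms_bounded (m j : nat) (x : X) : (1 <= m)%nat -> ahead m j ->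
  stable_weight m j * norm (stable A P j m x)
    <= D * Rpower (nu m) eps * norm x.
Proof.
unfold ahead; intros hm hj; rewrite Rmult_assoc.
apply weighted_bound.
- apply Rdiv_lt_0_compat; apply nu_pos; lia.
- rewrite <- Rmult_assoc; revert x; apply op_norm_le_iff.
  + now apply stable_linear.
  + repeat apply Rmult_le_pos; (left; apply Rpower_pos) || lra.
  + now apply stable_bound.
Qed.

Lemma unstable_terms_bounded (m j : nat) (x : X) : behind m j ->
  unstable_weight m j * norm (unstable A P j m x)
    <= D * Rpower (nu m) eps * norm x.
Proof.
intros [hj hjm]; rewrite Rmult_assoc.
apply weighted_bound.
- apply Rdiv_lt_0_compat; apply nu_pos; lia.
- rewrite <- Rmult_assoc; revert x; apply op_norm_le_iff.
  + now apply unstable_linear.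
  + repeat apply Rmult_le_pos; (left; apply Rpower_pos) || lra.
  + now apply unstable_bound.
Qed.

Section FixedTime.

Context {m : nat}.
Hypothesis hm : (1 <= m)%nat.

Let ahead_m : ahead m m := le_n m.
Let behind_m : behind m m := conj hm (le_n m).

Let stable_weight_ge0 (j : nat) : ahead m j -> 0 <= stable_weight m j.
Proof. intros _; left; apply Rpower_pos. Qed.

Let unstable_weight_ge0 (j : nat) : behind m j -> 0 <= unstable_weight m j.
Proof. intros _; left; apply Rpower_pos. Qed.

Let stable_lin (j : nat) : ahead m j -> algebraically_linear (stable A P j m).
Proof. intros hj; now apply stable_linear. Qed.

Let unstable_lin (j : nat) :
  behind m j -> algebraically_linear (unstable A P j m).
Proof. intros [hj hjm]; now apply unstable_linear. Qed.

Let stable_bdd (j : nat) (x : X) (hj : ahead m j) :=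
  stable_terms_bounded m j x hm hj.

Let unstable_bdd (j : nat) (x : X) (hj : behind m j) :=
  unstable_terms_bounded m j x hj.

Lemma stable_sup_nonneg (x : X) : 0 <= stable_sup m x.
Proof. exact (weighted_sup_nonneg ahead_m stable_weight_ge0 stable_bdd x). Qed.

Lemma unstable_sup_nonneg (x : X) : 0 <= unstable_sup m x.
Proof.
exact (weighted_sup_nonneg behind_m unstable_weight_ge0 unstable_bdd x).
Qed.

Lemma lyapunov_norm_nonneg (x : X) : 0 <= lyapunov_norm m x.
Proof.
apply Rplus_le_le_0_compat; [apply stable_sup_nonneg | apply unstable_sup_nonneg].
Qed.

(** The terms [j = m] of both suprema have weight 1 and are the norms of the two
    components of [x]. *)
Lemma norm_le_lyapunov_norm (x : X) : norm x <= lyapunov_norm m x.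
Proof.
rewrite <- (stable_plus_unstable AP m x hm) at 1.
apply Rle_trans
  with (1 := norm_triangle (stable A P m m x) (unstable A P m m x)).
assert (hnu := nu_pos m hm).
apply Rplus_le_compat.
- assert (h := weighted_sup_ge stable_bdd m x ahead_m).
  unfold stable_weight at 1 in h; rewrite Rdiv_diag in h by lra.
  rewrite Rpower_base1, Rmult_1_l in h; exact h.
- assert (h := weighted_sup_ge unstable_bdd m x behind_m).
  unfold unstable_weight at 1 in h; rewrite Rdiv_diag in h by lra.
  rewrite Rpower_base1, Rmult_1_l in h; exact h.
Qed.

Lemma lyapunov_norm_le (x : X) :
  lyapunov_norm m x <= 2 * D * Rpower (nu m) eps * norm x.
Proof.
assert (h1 := weighted_sup_bounded ahead_m stable_bdd x).
assert (h2 := weighted_sup_bounded behind_m unstable_bdd x).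
replace (2 * D * Rpower (nu m) eps * norm x)
  with (D * Rpower (nu m) eps * norm x + D * Rpower (nu m) eps * norm x)
  by ring.
exact (Rplus_le_compat _ _ _ _ h1 h2).
Qed.

Lemma lyapunov_is_norm : is_norm (lyapunov_norm m).
Proof.
constructor.
- exact lyapunov_norm_nonneg.
- intros x hx; apply (norm_eq_zero (V := X)), Rle_antisym; [ | apply norm_ge_0].
  rewrite <- hx; apply norm_le_lyapunov_norm.
- apply homogeneous_of_le; [exact lyapunov_norm_nonneg | intros a x].
  unfold lyapunov_norm; rewrite Rmult_plus_distr_l.
  apply Rplus_le_compat.
  + exact (weighted_sup_scal_le ahead_m stable_lin stable_bdd a x).
  + exact (weighted_sup_scal_le behind_m unstable_lin unstable_bdd a x).
- intros x y; unfold lyapunov_norm.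
  replace (stable_sup m x + unstable_sup m x
             + (stable_sup m y + unstable_sup m y))
    with (stable_sup m x + stable_sup m y
            + (unstable_sup m x + unstable_sup m y)) by ring.
  apply Rplus_le_compat.
  + exact (weighted_sup_subadditive ahead_m stable_weight_ge0 stable_lin
             stable_bdd x y).
  + exact (weighted_sup_subadditive behind_m unstable_weight_ge0 unstable_lin
             unstable_bdd x y).
Qed.

Lemma lyapunov_is_equivalent_norm : is_equivalent_norm (lyapunov_norm m).
Proof.
split; [exact lyapunov_is_norm | ].
exists 1, (2 * D * Rpower (nu m) eps); split; [lra | split].
- repeat apply Rmult_lt_0_compat; apply Rpower_pos || lra.
- intros x; split; [ | apply lyapunov_norm_le].
  rewrite Rmult_1_l; apply norm_le_lyapunov_norm.
Qed.

End FixedTime.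

(** The unstable supremum vanishes at a stable vector.  In the stable one, the
    weight relative to time [m] is the weight relative to time [n] times the
    decay factor, and only the indices [j >= m] remain. *)
Lemma lyapunov_stable_bound (m n : nat) (x : X) :
  (1 <= n)%nat -> (n <= m)%nat ->
  lyapunov_norm m (stable A P m n x)
    <= Rpower (nu m / nu n) (- lambda) * lyapunov_norm n x.
Proof.
intros hn hnm; unfold lyapunov_norm.
assert (hm : (1 <= m)%nat) by lia.
assert (hnum := nu_pos m hm); assert (hnun := nu_pos n hn).
assert (h0 : unstable_sup m (stable A P m n x) <= 0).
{ apply (sup_over_le _ _ m); [now split | intros j [hj hjm]].
  rewrite (norm_eq_0_of_zero _
             (unstable_stable A_linear AP _ _ _ x hn hnm hj hjm)).
  lra. }
assert (h1 : stable_sup m (stable A P m n x)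
              <= Rpower (nu m / nu n) (- lambda) * stable_sup n x).
{ apply (sup_over_le _ _ m); [apply le_n | unfold ahead; intros j hj].
  rewrite (stable_stable AP) by assumption.
  unfold stable_weight at 1; rewrite ratio_power_opp by assumption.
  rewrite <- (ratio_power_chain (nu j) (nu n) (nu m)), (Rmult_comm (Rpower _ _))
    by (try assumption; apply nu_pos; lia).
  rewrite Rmult_assoc; apply Rmult_le_compat_l; [left; apply Rpower_pos | ].
  apply (weighted_sup_ge (fun i y => stable_terms_bounded n i y hn)).
  unfold ahead; lia. }
assert (h2 : 0 <= Rpower (nu m / nu n) (- lambda) * unstable_sup n x).
{ apply Rmult_le_pos; [left; apply Rpower_pos | now apply unstable_sup_nonneg]. }
lra.
Qed.

(** The mirror image of the stable case: only the indices [j <= m] remain in the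
    unstable supremum. *)
Lemma lyapunov_unstable_bound (m n : nat) (x : X) :
  (1 <= m)%nat -> (m <= n)%nat ->
  lyapunov_norm m (unstable A P m n x)
    <= Rpower (nu n / nu m) (- lambda) * lyapunov_norm n x.
Proof.
intros hm hmn; unfold lyapunov_norm.
assert (hn : (1 <= n)%nat) by lia.
assert (hnum := nu_pos m hm); assert (hnun := nu_pos n hn).
assert (h0 : stable_sup m (unstable A P m n x) <= 0).
{ apply (sup_over_le _ _ m); [apply le_n | unfold ahead; intros j hj].
  rewrite (norm_eq_0_of_zero _ (stable_unstable A_linear AP _ _ _ x hm hmn hj)).
  lra. }
assert (h1 : unstable_sup m (unstable A P m n x)
              <= Rpower (nu n / nu m) (- lambda) * unstable_sup n x).
{ apply (sup_over_le _ _ m); [now split | intros j [hj hjm]].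
  rewrite (unstable_unstable AP) by assumption.
  unfold unstable_weight at 1; rewrite ratio_power_opp by assumption.
  rewrite <- (ratio_power_chain (nu m) (nu n) (nu j))
    by (try assumption; apply nu_pos; lia).
  rewrite Rmult_assoc; apply Rmult_le_compat_l; [left; apply Rpower_pos | ].
  apply (weighted_sup_ge (unstable_terms_bounded n)).
  split; lia. }
assert (h2 : 0 <= Rpower (nu n / nu m) (- lambda) * stable_sup n x).
{ apply Rmult_le_pos; [left; apply Rpower_pos | now apply stable_sup_nonneg]. }
lra.
Qed.

End LyapunovNorms.

(** * The equivalence *)

(** A norm bounded below by [norm] and above by the growth factor turns a bound
    in that norm into a nonuniform bound. *)
Lemma op_norm_of_adapted_bound (k : scalar_field)
    (X : CompleteNormedModule (scalars k)) (T : X -> X) (N N' : X -> R)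
    (n : nat) (C eps D r : R) :
  (1 <= n)%nat -> 0 < C -> 0 <= eps -> 0 < D -> 0 <= r ->
  algebraically_linear T ->
  (forall x : X, norm x <= N' x) ->
  (forall x : X, N x <= C * Rpower (ln (INR n + 2)) eps * norm x) ->
  (forall x : X, N' (T x) <= D * r * N x) ->
  Rbar_le (op_norm T)
    (D * C * (Rpower 2 eps * / ln 2) * r * Rpower (nu n) (eps + 1)).
Proof.
intros hn hC heps hD hr hT hlow hup hTN.
assert (hln2 := Rinv_0_lt_compat _ ln2_pos).
assert (h2 := Rpower_pos 2 eps).
apply op_norm_le_iff; [exact hT | | intros x].
- repeat apply Rmult_le_pos; (left; apply Rpower_pos) || lra.
- apply Rle_trans with (1 := hlow (T x)), Rle_trans with (1 := hTN x).
  apply Rle_trans with (D * r * (C * Rpower (ln (INR n + 2)) eps * norm x)).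
  { apply Rmult_le_compat_l; [apply Rmult_le_pos; lra | apply hup]. }
  apply Rle_trans with (D * r * (C * (Rpower 2 eps * / ln 2
    * Rpower (nu n) (eps + 1)) * norm x)); [ | right; ring].
  apply Rmult_le_compat_l; [apply Rmult_le_pos; lra | ].
  apply Rmult_le_compat_r; [apply norm_ge_0 | ].
  apply Rmult_le_compat_l; [lra | now apply growth_le_nu_power].
Qed.

Theorem corollary6p13 (k : scalar_field) (X : CompleteNormedModule (scalars k))
    (A : nat -> X -> X)
    (hA : forall m : nat, (1 <= m)%nat -> is_linear (A m)) :
  nonuniform_log_dichotomy A <->
  exists C eps : R, 0 < C /\ 0 <= eps /\
    exists N : nat -> X -> R,
      (forall m : nat, (1 <= m)%nat -> is_equivalent_norm (N m)) /\
      nonuniform_log_dichotomy_wrt A N /\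
      forall (x : X) (m : nat), (1 <= m)%nat ->
        norm x <= N m x /\
        N m x <= C * Rpower (ln (INR m + 2)) eps * norm x.
Proof.
split.
- intros [P [lambda [D [eps [hl [hD [heps [AP [hS hU]]]]]]]]].
  exists (2 * D), eps; split; [lra | split; [lra | ]].
  exists (lyapunov_norm (A := A) (P := P) (lambda := lambda)).
  split; [ | split].
  + intros m hm; exact (lyapunov_is_equivalent_norm hA AP hD hS hU hm).
  + exists P, lambda, 1; split; [exact hl | split; [lra | split; [exact AP | ]]].
    split; intros m n h h' x; rewrite Rmult_1_l.
    * exact (lyapunov_stable_bound hA AP hD hS hU m n x h h').
    * exact (lyapunov_unstable_bound hA AP hD hS hU m n x h h').
  + intros x m hm; split.
    * exact (norm_le_lyapunov_norm hA AP hD hS hU hm x).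
    * apply Rle_trans with (1 := lyapunov_norm_le hA AP hD hS hU hm x).
      apply Rmult_le_compat_r; [apply norm_ge_0 | ].
      apply Rmult_le_compat_l; [lra | ].
      apply Rle_Rpower_l; [lra | ].
      split; [now apply nu_pos | apply nu_le_ln_add2].
- intros [C [eps [hC [heps [N [_ [[P [lambda [D [hl [hD [AP [hS hU]]]]]]]
    hN]]]]]]].
  exists P, lambda, (D * C * (Rpower 2 eps * / ln 2)), (eps + 1).
  split; [exact hl | split; [ | split; [lra | split; [exact AP | ]]]].
  { repeat apply Rmult_lt_0_compat; try assumption;
      [apply Rpower_pos | apply Rinv_0_lt_compat, ln2_pos]. }
  split; intros m n h h'.
  + apply (op_norm_of_adapted_bound k X (stable A P m n) (N n) (N m));
      try assumption; try lia.
    * left; apply Rpower_pos.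
    * now apply stable_linear.
    * intros x; apply hN; lia.
    * intros x; apply hN; lia.
    * intros x; now apply hS.
  + apply (op_norm_of_adapted_bound k X (unstable A P m n) (N n) (N m));
      try assumption; try lia.
    * left; apply Rpower_pos.
    * now apply unstable_linear.
    * intros x; apply hN; lia.
    * intros x; apply hN; lia.
    * intros x; now apply hU.
Qed.
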